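(* Let $A$ be a finite-dimensional complete Novikov algebra over a field of characteristic zero. Then $A$ is not simple.
   Context: A left-symmetric algebra over a field $\mathbb{F}$ is a vector space $A$ over $\mathbb{F}$ with a bilinear product $\cdot$ such that $(x\cdot y)\cdot z-x\cdot(y\cdot z)=(y\cdot x)\cdot z-y\cdot(x\cdot z)$ for all $x,y,z\in A$; it is a Novikov algebra if moreover $(x\cdot y)\cdot z=(x\cdot z)\cdot y$ for all $x,y,z\in A$. $A$ is complete if the right multiplication $R_x:y\mapsto y\cdot x$ is nilpotent for every $x\in A$. An algebra $A$ is simple if it is nonzero, has no two-sided ideal other than $\{0\}$ and $A$, and is not the one-dimensional algebra with zero product. *)

(* Defs.v *)
From HB Require Import structures.
From mathcomp Require Import all_boot all_order all_algebra.

Set Implicit Arguments.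
Unset Strict Implicit.
Unset Printing Implicit Defensive.

Import GRing.Theory.
Local Open Scope ring_scope.

(* An algebra is a finite-dimensional vector space [A] together with a product
   [mul : {bilinear A -> A -> A}]; associativity, commutativity and the
   existence of a unit are not assumed. *)
Section NonassociativeAlgebra.
Variables (F : fieldType) (A : vectType F).
Implicit Types (mul : {bilinear A -> A -> A}) (I : {vspace A}).

Definition left_symmetric mul : Prop :=
  forall x y z : A,
    mul (mul x y) z - mul x (mul y z) = mul (mul y x) z - mul y (mul x z).

Definition novikov mul : Prop :=
  left_symmetric mul /\
  (forall x y z : A, mul (mul x y) z = mul (mul x z) y).

Definition right_mult mul (x y : A) : A := mul y x.

Definition nilpotent_map (f : A -> A) : Prop :=
  exists n : nat, forall y : A, iter n f y = 0.

Definition complete mul : Prop :=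
  forall x : A, nilpotent_map (right_mult mul x).

Definition two_sided_ideal mul I : Prop :=
  forall x y : A, y \in I -> mul x y \in I /\ mul y x \in I.

Definition simple_algebra mul : Prop :=
  [/\ fullv != 0%VS :> {vspace A},
      forall I, two_sided_ideal mul I -> I = 0%VS \/ I = fullv
    & ~ (\dim (fullv : {vspace A}) = 1%N /\ forall x y : A, mul x y = 0)].

End NonassociativeAlgebra.

(* Main.v *)
Require Import Defs.
From HB Require Import structures.
From mathcomp Require Import all_boot all_order all_algebra.

Set Implicit Arguments.
Unset Strict Implicit.
Unset Printing Implicit Defensive.

Import GRing.Theory.
Local Open Scope ring_scope.

(** The identity (xy)z = (xz)y says that the right multiplications commute, and
    completeness that they are nilpotent.  The images of finitely many commuting
    nilpotent endomorphisms cannot span a nonzero space V: if V = S + fV with S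
    stable under f, then V = S + f^n V for all n, so f can be dropped.  Hence AA
    is a proper ideal.  If A is simple then AA = 0; but then every subspace is an ideal,
    hence dim A = 1 and A is the excluded one-dimensional zero algebra. *)

Section CommutingNilpotents.
Variables (F : fieldType) (V : vectType F).
Implicit Types (f g : 'End(V)) (S : {vspace V}).

Lemma fullv_sub_nilpotent f S :
  nilpotent_map f -> (f @: S <= S)%VS -> (fullv <= S + limg f)%VS ->
  (fullv <= S)%VS.
Proof.
case=> n fn0 fS fullS.
have iterS m v : v \in S -> iter m f v \in S.
  by move=> vS; elim: m => //= m IH; apply: (subvP fS); apply: memv_img.
(* V = S + f^m V for every m: in f^m w, split w as t + f u; then f^m t stays in S and f^(m+1) u
   remains. *)
have dec m v : exists2 s, s \in S & exists w, v = s + iter m f w.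
  elim: m v => [|m IH] v; first by exists 0; [exact: mem0v | exists v; rewrite add0r].
  have [s sS [w ->]] := IH v.
  have /memv_addP[t tS [_ /memv_imgP[u _ ->] ->]] :=
    subvP fullS w (memvf w).
  exists (s + iter m f t); first by rewrite rpredD ?iterS.
  exists u; rewrite -addrA; congr (_ + _).
  by elim: m {IH} => //= m ->; rewrite linearD.
apply/subvP => v _; have [s sS [w ->]] := dec n v.
by rewrite fn0 addr0.
Qed.

Lemma commuting_nilpotents_limg (fs : seq 'End(V)) :
  {in fs, forall f, nilpotent_map f} ->
  {in fs &, forall f g v, f (g v) = g (f v)} ->
  (fullv <= \sum_(f <- fs) limg f)%VS -> fullv = 0%VS :> {vspace V}.
Proof.
elim: fs => [|f fs IH] nil_fs comm_fs.
  by rewrite big_nil subv0 => /eqP.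
rewrite big_cons addvC => full_fs; apply: IH.
- by move=> g gfs; apply: nil_fs; rewrite inE gfs orbT.
- by move=> g h gfs hfs; apply: comm_fs; rewrite inE ?gfs ?hfs orbT.
apply: fullv_sub_nilpotent full_fs; first by apply: nil_fs; rewrite mem_head.
(* Here S is the sum of the remaining images. It is stable under f because f(gV) = g(fV) lies in
   gV. *)
rewrite limg_sum big_seq [X in (_ <= X)%VS]big_seq.
apply: (big_ind2 (fun U W => (U <= W)%VS)) => // [U1 U2 W1 W2|g gfs].
  exact: addvS.
apply/subvP => _ /memv_imgP[_ /memv_imgP[v _ ->] ->].
rewrite comm_fs ?mem_head ?inE ?gfs ?orbT //.
exact/memv_img/memvf.
Qed.

End CommutingNilpotents.

Lemma zero_product_not_simple (F : fieldType) (A : vectType F)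
    (mul : {bilinear A -> A -> A}) :
  (forall x y, mul x y = 0) -> ~ simple_algebra mul.
Proof.
move=> mul0 [nz ideals notZ]; apply: notZ; split => //.
(* The line through a nonzero vector is a nonzero ideal, hence all of A. *)
have v0 : vpick (fullv : {vspace A}) != 0 by rewrite vpick0.
have [||<-] := ideals <[vpick fullv]>%VS; last by rewrite dim_vline v0.
  by move=> x y _; rewrite !mul0 mem0v.
by move/eqP; rewrite -dimv_eq0 dim_vline v0.
Qed.

Section RightMultiplication.
Variables (F : fieldType) (A : vectType F) (mul : {bilinear A -> A -> A}).

Definition rmul_end (x : A) : 'End(A) := linfun (applyr mul x).

Lemma rmul_endE x y : rmul_end x y = mul y x.
Proof. by rewrite lfunE. Qed.

Lemma rmul_end_nilpotent x : complete mul -> nilpotent_map (rmul_end x).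
Proof.
move=> /(_ x)[n xn0]; exists n => y; rewrite -[RHS](xn0 y).
exact/eq_iter/rmul_endE.
Qed.

(** This is AA: by linearity in the right factor a basis suffices, which gives the finite family of
    endomorphisms that [commuting_nilpotents_limg] takes. *)
Definition square_vspace : {vspace A} :=
  (\sum_(f <- map rmul_end (vbasis fullv)) limg f)%VS.

Lemma mem_square_vspace x y : mul x y \in square_vspace.
Proof.
rewrite (coord_vbasis (memvf y)) linear_sumr memv_suml // => i _.
rewrite linearZr rpredZ // /square_vspace big_map -rmul_endE.
rewrite (big_nth 0) big_mkord size_tuple.
by apply: (subvP (sumv_sup i _ (subvv _))); rewrite ?memv_img ?memvf.
Qed.

End RightMultiplication.

Theorem proposition37 (F : fieldType) (charF0 : [pchar F]%R =i pred0)
    (A : vectType F) (mul : {bilinear A -> A -> A}%R)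
    (novA : novikov mul) (compA : complete mul) :
  ~ simple_algebra mul.
Proof.
move=> simpA; have [nz ideals _] := simpA.
have [_ mulAC] := novA.
have [|sq0|sq1] := ideals (square_vspace mul).
(* A subspace containing all products is an ideal. *)
- by move=> x y _; rewrite !mem_square_vspace.
- apply: (zero_product_not_simple _ simpA) => x y.
  by apply/eqP; rewrite -memv0 -sq0 mem_square_vspace.
move/eqP: nz; apply.
apply: (@commuting_nilpotents_limg _ _ (map (rmul_end mul) (vbasis fullv))).
- by move=> _ /mapP[x _ ->]; apply: rmul_end_nilpotent.
- by move=> _ _ /mapP[x _ ->] /mapP[y _ ->] v; rewrite !rmul_endE mulAC.
by rewrite -/(square_vspace mul) sq1.
Qed.
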